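(* Let $\mathfrak g=\mathfrak{osp}(m|2n)$ with $M=m-2n\notin\{1,2\}$, and let $\lambda\in\mathbb C$ with $\lambda\neq-\frac{M-4}{4(M-1)}$. Then the two-sided ideal $\mathcal J^1_\lambda$ of the tensor algebra $\otimes\mathfrak g=\bigoplus_{k\ge0}\otimes^k\mathfrak g$ generated by the elements $$X\otimes Y-X\circledcirc_1Y-\tfrac12[X,Y]-\lambda\langle X,Y\rangle\in\mathfrak g\otimes\mathfrak g\oplus\mathfrak g\oplus\mathbb C,\qquad X,Y\in\mathfrak g,$$ contains $\mathfrak g=\otimes^1\mathfrak g$.
   Context: Conventions: $\mathbb C^{m|2n}$ with parity $[a]=0$ for $a\le m$, $[a]=1$ otherwise; orthosymplectic metric $g_{ab}$ (invertible, $g_{ab}=0$ if $[a]\ne[b]$, $g_{ba}=(-1)^{[a][b]}g_{ab}$), $g^{ab}=g_{ab}$, indices raised/lowered by $V_a=\sum_bg_{ab}V^b$, $V^c=\sum_ag^{ac}V_a$; $M=m-2n$; standing assumption $m>4$, $n>1$. $\mathfrak g=\mathfrak{osp}(m|2n)$ is identified with tensors $A^{ab}=-(-1)^{[a][b]}A^{ba}$ with bracket $[A,B]^{ab}=\sum_c\big(A^a{}_cB^{cb}-(-1)^{[a][b]}A^b{}_cB^{ca}\big)$ and invariant form $\langle U,V\rangle=\sum_{a,b}U_{ab}V^{ba}$ (proportional to the Killing form). $\mathfrak g\otimes\mathfrak g$ is identified with tensors $T^{abcd}$ super-antisymmetric in $(a,b)$ and in $(c,d)$; $\mathfrak g\odot\mathfrak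 g$ (resp. $\mathfrak g\wedge\mathfrak g$) are those with $T^{abcd}=\pm(-1)^{([a]+[b])([c]+[d])}T^{cdab}$ (sign $+$, resp. $-$). Define $q(V)^{abcd}=\frac13\big(V^{abcd}+(-1)^{[a]([b]+[c])}V^{bcad}-(-1)^{[b][c]}V^{acbd}\big)$ on $\mathfrak g\odot\mathfrak g$ and $\phi(X)^{abcd}=\frac14\big(g^{bc}X^{ad}-(-1)^{[a][b]}g^{ac}X^{bd}-(-1)^{[c][d]}g^{bd}X^{ac}+(-1)^{[a][b]+[c][d]}g^{ad}X^{bc}\big)$ for $X\in\mathbb C^{m|2n}\otimes\mathbb C^{m|2n}$. The first Cartan product is $\mathfrak g\circledcirc_1\mathfrak g=\{V\in\mathfrak g\odot\mathfrak g:\sum_{b,c}g_{bc}V^{acbd}=0,\ q(V)=0\}$; for $M\notin\{1,2\}$, $\mathfrak g\otimes\mathfrak g=(\mathfrak g\circledcirc_1\mathfrak g)\oplus\mathrm{Im}(q)\oplus\phi(\mathbb C^{m|2n}\odot\mathbb C^{m|2n})\oplus(\mathfrak g\wedge\mathfrak g)$ as $\mathfrak g$-modules, and $X\circledcirc_1Y$ denotes the component of $X\otimes Y$ in $\mathfrak g\circledcirc_1\mathfrak g$. *)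

(* Defs.v *)
From HB Require Import structures.
From mathcomp Require Import all_boot all_order all_algebra.
Set Implicit Arguments. Unset Strict Implicit. Unset Printing Implicit Defensive.
Import Order.TTheory GRing.Theory Num.Theory.
Local Open Scope ring_scope.

Section Osp.
Variable C : fieldType.
Variables m n : nat.
(* index set of C^{m|2n}: {0,...,m+2n-1}; index a is odd iff a >= m *)
Local Notation I := 'I_(m + n.*2).

Definition par (a : I) : bool := (m <= a)%N.
Definition sgn (b : bool) : C := if b then -1 else 1.
Definition ss (a b : I) : C := sgn (par a && par b).

(* orthosymplectic metric g_{ab}, with g^{ab} = g_{ab} the inverse metric:
   sum_a g^{ac} g_{ab} = delta_{cb} *)
Definition is_osp_metric (g : I -> I -> C) : Prop :=
  [/\ forall a b, par a != par b -> g a b = 0,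
      forall a b, g b a = ss a b * g a b &
      forall b c, \sum_(a : I) g a c * g a b = (b == c)%:R].

Variable g : I -> I -> C.

(* osp(m|2n) as super-antisymmetric 2-tensors A^{ab} *)
Definition in_osp (A : I -> I -> C) : Prop :=
  forall a b, A a b = - (ss a b * A b a).

Definition lowr (A : I -> I -> C) (a c : I) : C := \sum_(d : I) g c d * A a d.
Definition lowboth (U : I -> I -> C) (a b : I) : C :=
  \sum_(c : I) \sum_(d : I) g a c * g b d * U c d.

Definition bracket (A B : I -> I -> C) (a b : I) : C :=
  \sum_(c : I) (lowr A a c * B c b - ss a b * lowr A b c * B c a).

Definition form (U V : I -> I -> C) : C :=
  \sum_(a : I) \sum_(b : I) lowboth U a b * V b a.

Definition T4 := I -> I -> I -> I -> C.

Definition in_gg (T : T4) : Prop :=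
  forall a b c d, T a b c d = - (ss a b * T b a c d) /\
                  T a b c d = - (ss c d * T a b d c).

Definition swsign (a b c d : I) : C :=
  sgn ((par a (+) par b) && (par c (+) par d)).

Definition in_sym2 (T : T4) : Prop :=
  in_gg T /\ forall a b c d, T a b c d = swsign a b c d * T c d a b.

Definition in_wedge2 (T : T4) : Prop :=
  in_gg T /\ forall a b c d, T a b c d = - (swsign a b c d * T c d a b).

Definition qmap (V : T4) : T4 := fun a b c d =>
  3%:R^-1 * (V a b c d + sgn (par a && (par b (+) par c)) * V b c a d
             - ss b c * V a c b d).

Definition in_cartan1 (V : T4) : Prop :=
  [/\ in_sym2 V,
      forall a d, \sum_(b : I) \sum_(c : I) g b c * V a c b d = 0 &
      forall a b c d, qmap V a b c d = 0].

Definition in_sym1 (Z : I -> I -> C) : Prop := forall a b, Z a b = ss a b * Z b a.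

Definition phimap (X : I -> I -> C) : T4 := fun a b c d =>
  4%:R^-1 * (g b c * X a d - ss a b * g a c * X b d - ss c d * g b d * X a c
             + ss a b * ss c d * g a d * X b c).

(* V is the component of X (x) Y in g @_1 g w.r.t. the decomposition
   g(x)g = (g@_1 g) + Im q + phi(C(.)C) + g/\g *)
Definition is_cartan1_comp (X Y : I -> I -> C) (V : T4) : Prop :=
  in_cartan1 V /\
  exists (W : T4) (Z : I -> I -> C) (T : T4),
    [/\ in_sym2 W, in_sym1 Z, in_wedge2 T &
        forall a b c d, X a b * Y c d - V a b c d =
                        qmap W a b c d + phimap Z a b c d + T a b c d].

(* The tensor algebra of C^{m|2n}: finitely supported functions on words. *)
Definition tens := seq I -> C.

Definition tbounded (t : tens) : Prop :=
  exists K : nat, forall s, (K < size s)%N -> t s = 0.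

Definition in_TG (t : tens) : Prop :=
  [/\ tbounded t,
      forall s, odd (size s) -> t s = 0 &
      forall s1 s2 a b, ~~ odd (size s1) ->
        t (s1 ++ a :: b :: s2) = - (ss a b * t (s1 ++ b :: a :: s2))].

Definition tmul (t u : tens) : tens := fun s =>
  \sum_(i < (size s).+1) t (take i s) * u (drop i s).

Definition t1 (A : I -> I -> C) : tens := fun s =>
  if s is [:: a; b] then A a b else 0.

Variable lam : C.

Definition genel (X Y : I -> I -> C) (V : T4) : tens := fun s =>
  match s with
  | [::] => - (lam * form X Y)
  | [:: a; b] => - (2%:R^-1 * bracket X Y a b)
  | [:: a; b; c; d] => X a b * Y c d - V a b c d
  | _ => 0
  end.

Inductive inJ : tens -> Prop :=
| inJ0 : inJ (fun _ => 0)
| inJadd t u : inJ t -> inJ u -> inJ (fun s => t s + u s)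
| inJscale (c : C) t : inJ t -> inJ (fun s => c * t s)
| inJgen u v X Y V : in_TG u -> in_TG v -> in_osp X -> in_osp Y ->
    is_cartan1_comp X Y V -> inJ (tmul (tmul u (genel X Y V)) v).

End Osp.

Definition Mval (C : fieldType) (m n : nat) : C := m%:R - (n.*2)%:R.

(* Main.v *)
(* Write L_pq for e_p /\ e_q in osp(m|2n), viewed in the quotient by the ideal.
   The Cartan component vanishes on the graded cyclic sum of L_pq (x) L_rs over
   p, q, r and on the trace elements sum_xy g^xy L_px (x) L_yq, so the
   generators give (signs omitted)
     (1)  L_pq L_rs + L_qr L_ps + L_rp L_qs = G_pqrs, where
          G_pqrs = g_sr L_pq + g_sp L_qr + g_sq L_rp;
     (2)  sum_xy g^xy L_px L_yq = mu g_qp + nu L_pq,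
          with mu = 2 (M - 1) lam and nu = (M - 2) / 2.
   Multiply (1) for (a, b, c, x) by L_ye and contract x with y.  By (2) and (1)
   the left side becomes (mu + nu) G_abce, while the right side is again the
   left side of (1) for (a, b, c, e), that is G_abce.  Hence
   (mu + nu - 1) G_abce = 0; contracting c with e gives
   (mu + nu - 1) (M - 2) L_ab = 0, and mu + nu = 1 exactly at the excluded
   value of lam. *)
Require Import Defs.
From HB Require Import structures.
From mathcomp Require Import all_boot all_order all_algebra.
From mathcomp Require Import ring.
From Stdlib Require Import FunctionalExtensionality.
Set Implicit Arguments. Unset Strict Implicit. Unset Printing Implicit Defensive.
Import Order.TTheory GRing.Theory Num.Theory.
Local Open Scope ring_scope.

(** Every sign depends only on parities, so fixing four of them leaves an identity with numerical
    coefficients, where [field] handles 1/2, 1/3 and 1/4. *)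
Ltac sign_cases a b c d :=
  rewrite /ss /swsign /sgn;
  case: (par a); case: (par b); case: (par c); case: (par d); rewrite /=; field.

(** * Contractions, alternation, and the projection onto the first Cartan product *)

Section Tensors.
Variables (C : numClosedFieldType) (m n : nat).
Local Notation I := 'I_(m + n.*2).
Variable g : I -> I -> C.
Hypothesis g_osp : is_osp_metric g.
Local Notation M := (Mval C m n).
Hypotheses (M1 : M != 1) (M2 : M != 2).
Local Notation ss := (@ss C m n).
Local Notation sgn := (@sgn C).
Local Notation swsign := (@swsign C m n).
Local Notation T4 := (T4 C m n).
Local Notation form2 := (I -> I -> C).
Local Notation in_sym1 := (@in_sym1 C m n).
Local Notation in_sym2 := (@in_sym2 C m n).
Local Notation in_gg := (@in_gg C m n).
Local Notation qmap := (@qmap C m n).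

(** Makes the vanishing of the metric across parities visible to a case analysis on parities: the
    factor becomes 0 or 1. *)
Lemma metricE a b : g a b = (par a == par b)%:R * g a b.
Proof.
by case: g_osp => gpar _ _; case: eqVneq => [_|/gpar->]; rewrite ?mul1r ?mulr0.
Qed.

Lemma ssC a b : ss a b = ss b a.
Proof. by rewrite /ss andbC. Qed.

Lemma metric_flip a b : g b a = ss a b * g a b.
Proof. by case: g_osp. Qed.

Lemma metric_orthl b c : \sum_a g a c * g a b = (b == c)%:R.
Proof. by case: g_osp. Qed.

Lemma metric_orthm b c : \sum_a g c a * g a b = ss c c * (b == c)%:R.
Proof.
rewrite -metric_orthl mulr_sumr; apply: eq_bigr => a _.
rewrite (metric_flip a c)  (metricE a c) (metricE a b).
rewrite /ss /sgn.
by case: (par a); case: (par b); case: (par c); rewrite /=; ring.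
Qed.

Lemma sum_deltal (a : I) (F : I -> C) : \sum_x (x == a)%:R * F x = F a.
Proof.
rewrite (bigD1 a) //= eqxx mul1r big1 ?addr0 // => x /negbTE->.
by rewrite mul0r.
Qed.

Lemma sum_ss : \sum_(a : I) ss a a = M.
Proof.
rewrite big_split_ord /= /Mval; congr (_ + _).
  rewrite (eq_bigr (fun=> 1)) ?sumr_const ?card_ord // => i _.
  by rewrite /ss /par andbb leqNgt /= ltn_ord.
rewrite (eq_bigr (fun=> -1)) ?sumr_const ?card_ord ?mulNrn // => i _.
by rewrite /ss /par andbb /= leq_addr.
Qed.

(** The contraction in the trace condition of the first Cartan product. On a tensor product of [X]
    and [Y] it is their matrix product, whose super-antisymmetrization is the bracket and whose
    [str] is the invariant form. *)
Definition tr (T : T4) : form2 := fun a d => \sum_b \sum_c g b c * T a c b d.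

Definition str (X : form2) : C := \sum_a \sum_d g d a * X a d.

Lemma str_metric : str g = M.
Proof.
rewrite -sum_ss; apply: eq_bigr => a _.
under eq_bigr => d _ do rewrite mulrC.
by rewrite metric_orthm eqxx mulr1.
Qed.

Lemma strD (X Y : form2) (k : C) :
  str (fun a d => X a d + k * Y a d) = str X + k * str Y.
Proof.
rewrite /str mulr_sumr -big_split; apply: eq_bigr => a _ /=.
rewrite mulr_sumr -big_split; apply: eq_bigr => d _ /=; ring.
Qed.

Lemma strZ (X : form2) k : str (fun a d => k * X a d) = k * str X.
Proof.
rewrite /str mulr_sumr; apply: eq_bigr => a _; rewrite mulr_sumr.
by apply: eq_bigr => d _; rewrite mulrCA.
Qed.

Lemma trD (T U : T4) (k : C) a d :
  tr (fun a b c d => T a b c d + k * U a b c d) a d = tr T a d + k * tr U a d.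
Proof.
rewrite /tr mulr_sumr -big_split; apply: eq_bigr => b _ /=.
rewrite mulr_sumr -big_split; apply: eq_bigr => c _ /=; ring.
Qed.

(** The first term of [phimap] closes a loop and contributes [M], the two middle terms each return
    [- X], and the last one contracts [X] itself. *)
Lemma tr_phimap X a d :
  tr (phimap g X) a d = 4^-1 * ((M - 2) * X a d + g a d * str X).
Proof.
have e1 : \sum_b \sum_c g b c * (g c b * X a d) = M * X a d.
  rewrite -str_metric /str mulr_suml; apply: eq_bigr => b _.
  by rewrite mulr_suml; apply: eq_bigr => c _; ring.
have e2 : \sum_b \sum_c g b c * (ss a c * g a b * X c d) = X a d.
  rewrite exchange_big /= -[RHS](sum_deltal a (fun c => X c d)).
  apply: eq_bigr => c _; rewrite eq_sym -metric_orthl mulr_suml.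
  apply: eq_bigr => b _; rewrite (metric_flip b a) (metricE b c) (metricE b a).
  rewrite /ss /sgn.
  by case: (par a); case: (par b); case: (par c); rewrite /=; ring.
have e3 : \sum_b \sum_c g b c * (ss b d * g c d * X a b) = X a d.
  rewrite -[RHS](sum_deltal d (fun b => X a b)).
  apply: eq_bigr => b _; rewrite -metric_orthl mulr_suml.
  apply: eq_bigr => c _; rewrite (metric_flip c b) (metricE c d) (metricE c b).
  rewrite /ss /sgn.
  by case: (par d); case: (par b); case: (par c); rewrite /=; ring.
have e4 : \sum_b \sum_c g b c * (ss a c * ss b d * g a d * X c b)
    = g a d * str X.
  rewrite /str exchange_big mulr_sumr; apply: eq_bigr => c _.
  rewrite mulr_sumr; apply: eq_bigr => b _.
  rewrite (metricE b c) (metricE a d) /ss /sgn.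
  by case: (par a); case: (par d); case: (par b); case: (par c);
    rewrite /=; ring.
have -> : (M - 2) * X a d = M * X a d - X a d - X a d by ring.
transitivity (4^-1 * (\sum_b \sum_c g b c * (g c b * X a d)
    - \sum_b \sum_c g b c * (ss a c * g a b * X c d)
    - \sum_b \sum_c g b c * (ss b d * g c d * X a b)
    + \sum_b \sum_c g b c * (ss a c * ss b d * g a d * X c b))).
  rewrite -!sumrN -!big_split mulr_sumr; apply: eq_bigr => b _ /=.
  rewrite -!sumrN -!big_split mulr_sumr; apply: eq_bigr => c _ /=.
  by rewrite /phimap; ring.
by rewrite e1 e2 e3 e4.
Qed.

Lemma qmap_sym2 V : in_sym2 V -> in_sym2 (qmap V).
Proof.
case=> Vgg Vsw.
have Vl a b c d : V a b c d = - (ss a b * V b a c d) by case: (Vgg a b c d).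
have Vr a b c d : V a b c d = - (ss c d * V a b d c) by case: (Vgg a b c d).
split=> [a b c d|a b c d]; first split; rewrite /qmap.
- by rewrite (Vl b a c d); sign_cases a b c d.
- rewrite (Vr a b d c) (Vsw b d a c) (Vsw a d b c).
  by sign_cases a b c d.
- rewrite (Vsw c d a b) (Vsw d a c b) (Vl c b d a) (Vr b c d a).
  rewrite (Vl c a d b) (Vr a c d b).
  by sign_cases a b c d.
Qed.

Lemma qmapB (S T : T4) a b c d :
  qmap (fun a b c d => S a b c d - T a b c d) a b c d =
  qmap S a b c d - qmap T a b c d.
Proof. by rewrite /qmap; ring. Qed.

(** Together with super-antisymmetry in the outer pairs, this makes the image of [qmap] totally
    super-antisymmetric. *)
Lemma qmap_alt V a b c d :
  in_sym2 V -> qmap V a c b d = - (ss b c * qmap V a b c d).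
Proof.
case=> Vgg _; rewrite /qmap; case: (Vgg b c a d) => -> _.
by sign_cases a b c d.
Qed.

(** The three terms of [qmap] coincide on a totally super-antisymmetric tensor; with [qmap_alt],
    [qmap] is thus an idempotent. *)
Lemma qmap_fix V a b c d : in_sym2 V ->
  (forall a b c d, V a c b d = - (ss b c * V a b c d)) ->
  qmap V a b c d = V a b c d.
Proof.
case=> Vgg _ Valt; rewrite /qmap (Valt b a c d) (Valt a b c d).
by case: (Vgg b a c d) => -> _; sign_cases a b c d.
Qed.

Definition sym (T : T4) : T4 :=
  fun a b c d => 2^-1 * (T a b c d + swsign a b c d * T c d a b).

Lemma sym_sym2 T : in_gg T -> in_sym2 (sym T).
Proof.
move=> Tgg; split=> [a b c d|a b c d]; first split; rewrite /sym.
- case: (Tgg a b c d) => -> _; case: (Tgg c d a b) => _ ->.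
  by sign_cases a b c d.
- case: (Tgg a b c d) => _ ->; case: (Tgg c d a b) => -> _.
  by sign_cases a b c d.
- by sign_cases a b c d.
Qed.

Lemma phimap_sym2 Z : in_sym1 Z -> in_sym2 (phimap g Z).
Proof.
move=> Zs; split=> [a b c d|a b c d]; first split; rewrite /phimap.
- by sign_cases a b c d.
- by sign_cases a b c d.
- rewrite (Zs c b) (Zs d b) (Zs c a) (Zs d a).
  rewrite (metric_flip a d) (metric_flip a c).
  rewrite (metric_flip b d) (metric_flip b c).
  rewrite (metricE a d) (metricE a c) (metricE b d) (metricE b c).
  by sign_cases a b c d.
Qed.

(** Each term is a product of two supersymmetric factors, [g] and [Z], so alternation kills it. *)
Lemma qmap_phimap Z a b c d : in_sym1 Z -> qmap (phimap g Z) a b c d = 0.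
Proof.
move=> Zs; rewrite /qmap /phimap (Zs c b) (Zs b a) (Zs c a).
rewrite (metric_flip a b) (metric_flip a c) (metric_flip b c).
rewrite (metricE a d) (metricE a c) (metricE b d) (metricE b c).
rewrite (metricE a b) (metricE c d).
by sign_cases a b c d.
Qed.

Lemma funext4 (T U : T4) : (forall a b c d, T a b c d = U a b c d) -> T = U.
Proof.
by move=> eqTU; do 4![apply: functional_extensionality => ?]; apply: eqTU.
Qed.

Lemma funext2 (X Y : form2) : (forall a b, X a b = Y a b) -> X = Y.
Proof.
by move=> eqXY; do 2![apply: functional_extensionality => ?]; apply: eqXY.
Qed.

Lemma trB (T U : T4) a d :
  tr (fun a b c d => T a b c d - U a b c d) a d = tr T a d - tr U a d.
Proof.
rewrite -[in RHS]mulN1r -trD; congr (tr _ a d).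
by apply: funext4 => *; rewrite mulN1r.
Qed.

Lemma tr_sym1 S : in_sym2 S -> in_sym1 (tr S).
Proof.
case=> Sgg Ssw a d; rewrite /tr exchange_big mulr_sumr; apply: eq_bigr => c _.
rewrite mulr_sumr; apply: eq_bigr => b _.
rewrite (Ssw a c b d); case: (Sgg b d a c) => -> _; case: (Sgg d b a c) => _ ->.
by rewrite (metric_flip c b) (metricE c b); sign_cases a b c d.
Qed.

(** What remains of [T] once its components in the exterior square and in the image of [qmap] are
    removed. *)
Definition nonalt (T : T4) : T4 :=
  fun a b c d => sym T a b c d - qmap (sym T) a b c d.

(* [ztr] inverts [tr \o phimap g]. *)
Definition ztr (t : form2) : form2 :=
  fun a d => 4 / (M - 2) * (t a d - g a d * str t / (2 * (M - 1))).

(* The projection of g (x) g onto the first Cartan product. *)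
Definition proj (T : T4) : T4 :=
  fun a b c d => nonalt T a b c d - phimap g (ztr (tr (nonalt T))) a b c d.

Let M1' : M - 1 != 0. Proof. by rewrite subr_eq0. Qed.
Let M2' : M - 2 != 0. Proof. by rewrite subr_eq0. Qed.

Lemma str_ztr t : str (ztr t) = 2 * str t / (M - 1).
Proof.
have e : ztr t = fun a d =>
    4 / (M - 2) * (t a d + - (str t / (2 * (M - 1))) * g a d).
  by apply: funext2 => *; rewrite /ztr; field; apply/andP.
by rewrite e strZ strD str_metric; field; apply/andP.
Qed.

Lemma ztr_sym1 t : in_sym1 t -> in_sym1 (ztr t).
Proof.
move=> ts a d; rewrite /ztr (ts a d) (metric_flip d a) (ssC d a).
by ring.
Qed.

Lemma tr_phimap_ztr t a d : tr (phimap g (ztr t)) a d = t a d.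
Proof. by rewrite tr_phimap str_ztr /ztr; field; apply/andP. Qed.

Lemma ztr_tr_phimap X : ztr (tr (phimap g X)) = X.
Proof.
apply: funext2 => a d; rewrite /ztr.
(* By [tr_phimap] and [str_metric] the factor is ((M - 2) + M) / 4. *)
have -> : str (tr (phimap g X)) = (M - 1) / 2 * str X.
  have -> : tr (phimap g X) =
            fun a d => 4^-1 * ((M - 2) * (X a d + str X / (M - 2) * g a d)).
    by apply: funext2 => *; rewrite tr_phimap; field.
  by rewrite !strZ strD str_metric; field.
rewrite tr_phimap; field; exact/andP.
Qed.

Lemma in_sym2B S T : in_sym2 S -> in_sym2 T ->
  in_sym2 (fun a b c d => S a b c d - T a b c d).
Proof.
move=> [Sgg Ssw] [Tgg Tsw]; split=> [a b c d|a b c d]; last first.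
  by rewrite Ssw Tsw mulrBr.
by split; [case: (Sgg a b c d) (Tgg a b c d) => -> _ [-> _]
         | case: (Sgg a b c d) (Tgg a b c d) => _ -> [_ ->]]; ring.
Qed.

Lemma nonalt_sym2 T : in_gg T -> in_sym2 (nonalt T).
Proof. by move=> /sym_sym2 S2; apply: in_sym2B => //; apply: qmap_sym2. Qed.

Lemma qmap_nonalt T a b c d : in_gg T -> qmap (nonalt T) a b c d = 0.
Proof.
move=> /sym_sym2 S2.
rewrite qmapB (qmap_fix _ _ _ _ (qmap_sym2 S2)) ?subrr // => *.
exact: qmap_alt.
Qed.

Lemma proj_cartan T : in_gg T -> in_cartan1 g (proj T).
Proof.
move=> Tgg; have N2 := nonalt_sym2 Tgg.
have Zs : in_sym1 (ztr (tr (nonalt T))) by apply/ztr_sym1/tr_sym1.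
split=> [|a d|a b c d].
- by apply: in_sym2B => //; apply: phimap_sym2.
- by rewrite -[LHS]/(tr _ a d) trB tr_phimap_ztr subrr.
- by rewrite qmapB qmap_nonalt // qmap_phimap // subr0.
Qed.

(** Symmetrizing [phimap g X] replaces [X] by its supersymmetric part [Y], and [phimap g Y] is
    recovered from its trace by [ztr]. Arbitrary [X] is allowed so that dyads can be inserted. *)
Lemma proj_phimap X a b c d : proj (phimap g X) a b c d = 0.
Proof.
pose Y : form2 := fun a b => 2^-1 * (X a b + ss a b * X b a).
have Ys : in_sym1 Y by move=> x y; rewrite /Y; sign_cases x y c d.
have eS : sym (phimap g X) = phimap g Y.
  apply: funext4 => {}a {}b {}c {}d; rewrite /sym /phimap /Y.
  rewrite (metric_flip a d) (metric_flip a c).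
  rewrite (metric_flip b d) (metric_flip b c).
  rewrite (metricE a d) (metricE a c) (metricE b d) (metricE b c).
  by sign_cases a b c d.
have eN : nonalt (phimap g X) = phimap g Y.
  by apply: funext4 => *; rewrite /nonalt eS qmap_phimap ?subr0.
by rewrite /proj eN ztr_tr_phimap subrr.
Qed.

(** A totally alternating symmetric part is fixed by [qmap], so [nonalt T] is zero. *)
Lemma proj_alt T a b c d : in_gg T ->
  (forall a b c d, sym T a c b d = - (ss b c * sym T a b c d)) ->
  proj T a b c d = 0.
Proof.
move=> Tgg Talt; have eN : nonalt T = fun _ _ _ _ => 0.
  apply: funext4 => *; rewrite /nonalt qmap_fix ?subrr //; exact: sym_sym2.
have tr0 x y : tr (fun _ _ _ _ => 0) x y = 0.
  by rewrite /tr big1 // => ? _; rewrite big1 // => ? _; rewrite mulr0.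
have str0 : str (tr (fun _ _ _ _ => 0)) = 0.
  by rewrite /str big1 // => ? _; rewrite big1 // => ? _; rewrite tr0 mulr0.
by rewrite /proj eN /phimap /ztr str0 !tr0; ring.
Qed.

Lemma projD T U k a b c d :
  proj (fun a b c d => T a b c d + k * U a b c d) a b c d =
  proj T a b c d + k * proj U a b c d.
Proof.
have eN : nonalt (fun a b c d => T a b c d + k * U a b c d) =
          fun a b c d => nonalt T a b c d + k * nonalt U a b c d.
  by apply: funext4 => *; rewrite /nonalt /qmap /sym; ring.
rewrite /proj eN.
have -> : tr (fun a b c d => nonalt T a b c d + k * nonalt U a b c d) =
          fun a d => tr (nonalt T) a d + k * tr (nonalt U) a d.
  by apply: funext2 => *; rewrite trD.
by rewrite /phimap /ztr !strD; ring.
Qed.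

End Tensors.

(** * The spanning elements e_p /\ e_q, their graded cyclic sums and their traces *)

Section Generators.
Variables (C : numClosedFieldType) (m n : nat).
Local Notation I := 'I_(m + n.*2).
Variable g : I -> I -> C.
Hypothesis g_osp : is_osp_metric g.
Local Notation ss := (@ss C m n).
Local Notation sgn := (@sgn C).
Local Notation swsign := (@swsign C m n).
Local Notation T4 := (T4 C m n).
Local Notation form2 := (I -> I -> C).
Local Notation in_osp := (@in_osp C m n).
Local Notation in_gg := (@in_gg C m n).

Definition delta (p a : I) : C := (a == p)%:R.

Definition E (p q : I) : form2 :=
  fun a b => delta p a * delta q b - ss a b * delta q a * delta p b.

Definition otimes (X Y : form2) : T4 := fun a b c d => X a b * Y c d.

Lemma deltaE p a : delta p a = (par p == par a)%:R * delta p a.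
Proof.
rewrite /delta; case: (eqVneq a p) => [->|_]; last by rewrite mulr0.
by rewrite eqxx mulr1.
Qed.

Lemma E_osp p q : in_osp (E p q).
Proof. by move=> a b; rewrite /E; sign_cases a b a b. Qed.

Lemma otimes_gg X Y : in_osp X -> in_osp Y -> in_gg (otimes X Y).
Proof.
move=> hX hY a b c d; rewrite /otimes.
by split; [rewrite hX|rewrite hY]; ring.
Qed.

Lemma E_flip p q a b : E q p a b = - (ss p q * E p q a b).
Proof.
rewrite /E (deltaE p a) (deltaE q a) (deltaE p b) (deltaE q b).
by sign_cases p q a b.
Qed.

(** The Koszul sign for moving e_p past e_q and e_r. *)
Definition cycsign (p q r : I) : C := sgn (par p && (par q (+) par r)).

Definition cyc (p q r s : I) : T4 := fun a b c d =>
  otimes (E p q) (E r s) a b c d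
  + cycsign p q r * otimes (E q r) (E p s) a b c d
  + cycsign r p q * otimes (E r p) (E q s) a b c d.

(** The deltas force the parities of labels and indices to agree, so the sign can be read off the
    labels. It is then constant in contractions over the indices. *)
Lemma E_label p q a b :
  E p q a b = delta p a * delta q b - ss p q * delta q a * delta p b.
Proof.
rewrite /E (deltaE q a) (deltaE p b).
by sign_cases p q a b.
Qed.

Lemma E_par p q a b :
  E p q a b = (par p (+) par q == par a (+) par b)%:R * E p q a b.
Proof.
rewrite /E (deltaE p a) (deltaE q a) (deltaE p b) (deltaE q b).
by sign_cases p q a b.
Qed.

Lemma sym_otimes_E p q r s a b c d :
  sym (otimes (E p q) (E r s)) a b c d =
  2^-1 * (E p q a b * E r s c d + swsign p q r s * (E r s a b * E p q c d)).
Proof.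
rewrite /sym /otimes; congr (_ * (_ + _)).
rewrite (E_par p q c d) (E_par r s a b) /swsign.
case: (par a (+) par b); case: (par c (+) par d);
case: (par p (+) par q); case: (par r (+) par s); rewrite /=; ring.
Qed.

(** Cyclic summation over [p], [q], [r] followed by the exchange of pairs produces a full graded
    alternation of the four labels. *)
Lemma sym_cyc_alt p q r s a b c d :
  sym (cyc p q r s) a c b d = - (ss b c * sym (cyc p q r s) a b c d).
Proof.
have e x y z w : sym (cyc p q r s) x y z w =
    sym (otimes (E p q) (E r s)) x y z w
    + cycsign p q r * sym (otimes (E q r) (E p s)) x y z w
    + cycsign r p q * sym (otimes (E r p) (E q s)) x y z w.
  by rewrite /sym /cyc; ring.
rewrite !{}e !sym_otimes_E !E_label /cycsign.
rewrite (deltaE p b) (deltaE p c) (deltaE q b) (deltaE q c).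
rewrite (deltaE r b) (deltaE r c) (deltaE s b) (deltaE s c).
(* With the parity constraints at [b] and [c] recorded, the deltas can be treated as sixteen
   indeterminates: a polynomial identity remains for each choice of parities. *)
move: (delta p a) (delta p b) (delta p c) (delta p d).
move: (delta q a) (delta q b) (delta q c) (delta q d).
move: (delta r a) (delta r b) (delta r c) (delta r d).
move: (delta s a) (delta s b) (delta s c) (delta s d).
move=> x1 x2 x3 x4 x5 x6 x7 x8 x9 x10 x11 x12 x13 x14 x15 x16.
rewrite /ss /swsign /sgn.
case: (par b); case: (par c);
rewrite /= ?(mul0r, mulr0, mul1r, add0r,addr0,subr0,oppr0).
all: case: (par p); case: (par q); case: (par r); case: (par s).
all: rewrite /=; ring.
Qed.

Lemma sum_delta2 (p q : I) (F : I -> I -> C) :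
  \sum_x \sum_y F x y * (delta p x * delta q y) = F p q.
Proof.
under eq_bigr => x _.
  under eq_bigr => y _ do rewrite mulrC -mulrA.
  rewrite -mulr_sumr sum_deltal. over.
exact: (sum_deltal p (fun x => F x q)).
Qed.

Lemma tr_otimes_E p q r s a d :
  tr g (otimes (E p q) (E r s)) a d =
  g r q * (delta p a * delta s d) - ss p q * g r p * (delta q a * delta s d)
  - ss r s * g s q * (delta p a * delta r d)
  + ss p q * ss r s * g s p * (delta q a * delta r d).
Proof.
have e k x y u v :
    \sum_b \sum_c g b c *
      (k * (delta x a * delta y c * (delta u b * delta v d))) =
    k * (g u y * (delta x a * delta v d)).
  rewrite -(sum_delta2 u y (fun b c => k * (g b c * (delta x a * delta v d)))).
  by apply: eq_bigr => b _; apply: eq_bigr => c _; ring.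
transitivity (1 * (g r q * (delta p a * delta s d))
  - ss p q * (g r p * (delta q a * delta s d))
  - ss r s * (g s q * (delta p a * delta r d))
  + ss p q * ss r s * (g s p * (delta q a * delta r d))); last by ring.
rewrite -!e -!sumrN -!big_split; apply: eq_bigr => b _ /=.
rewrite -!sumrN -!big_split; apply: eq_bigr => c _ /=.
by rewrite /otimes !E_label; ring.
Qed.

Lemma str_tr_otimes_E p q r s :
  str g (tr g (otimes (E p q) (E r s))) =
  g s p * g r q - ss p q * g s q * g r p - ss r s * g r p * g s q
  + ss p q * ss r s * g r q * g s p.
Proof.
have e x y k : \sum_a \sum_d g d a * (k * (delta x a * delta y d)) = k * g y x.
  rewrite -(sum_delta2 x y (fun a d => k * g d a)).
  by apply: eq_bigr => b _; apply: eq_bigr => c _; ring.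
transitivity (g r q * g s p - ss p q * g r p * g s q - ss r s * g s q * g r p
  + ss p q * ss r s * g s p * g r q); last by ring.
rewrite -(e p s (g r q)) -(e q s (ss p q * g r p)) -(e p r (ss r s * g s q)).
rewrite -(e q r (ss p q * ss r s * g s p)) -!sumrN -!big_split.
apply: eq_bigr => a _ /=.
rewrite -!sumrN -!big_split; apply: eq_bigr => d _ /=.
by rewrite tr_otimes_E; ring.
Qed.

Lemma tr_cyc p q r s a d : tr g (cyc p q r s) a d =
  tr g (otimes (E p q) (E r s)) a d
  + cycsign p q r * tr g (otimes (E q r) (E p s)) a d
  + cycsign r p q * tr g (otimes (E r p) (E q s)) a d.
Proof. by rewrite -!trD. Qed.

(** The first Bianchi identity for the form on e_p /\ e_q and e_r /\ e_s, a curvature-type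
    expression in the metric. Hence (1) has no constant term. *)
Lemma str_tr_cyc p q r s : str g (tr g (cyc p q r s)) = 0.
Proof.
have -> : tr g (cyc p q r s) = fun a d => tr g (otimes (E p q) (E r s)) a d
  + cycsign p q r * tr g (otimes (E q r) (E p s)) a d
  + cycsign r p q * tr g (otimes (E r p) (E q s)) a d.
  by apply: funext2 => *; apply: tr_cyc.
rewrite !strD !str_tr_otimes_E /cycsign.
rewrite (metric_flip g_osp p s) (metric_flip g_osp q s) (metric_flip g_osp r s).
rewrite (metric_flip g_osp p q) (metric_flip g_osp p r) (metric_flip g_osp q r).
rewrite (metricE g_osp p s) (metricE g_osp q s) (metricE g_osp r s).
rewrite (metricE g_osp p q) (metricE g_osp p r) (metricE g_osp q r).
by sign_cases p q r s.
Qed.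

(** In the sum of the three brackets, terms with a metric between two of [p], [q], [r] cancel, while
    those with a metric involving [s] occur twice, which absorbs the factor 1/2. *)
Lemma bracket_cyc p q r s a d :
  2^-1 * (tr g (cyc p q r s) a d - ss a d * tr g (cyc p q r s) d a) =
  g s r * E p q a d + cycsign p q r * g s p * E q r a d
  + cycsign r p q * g s q * E r p a d.
Proof.
rewrite !tr_cyc !tr_otimes_E !E_label /cycsign.
rewrite (metric_flip g_osp p s) (metric_flip g_osp q s) (metric_flip g_osp r s).
rewrite (metric_flip g_osp p q) (metric_flip g_osp p r) (metric_flip g_osp q r).
rewrite (metricE g_osp p s) (metricE g_osp q s) (metricE g_osp r s).
rewrite (metricE g_osp p q) (metricE g_osp p r) (metricE g_osp q r).
rewrite (deltaE p a) (deltaE q a) (deltaE r a) (deltaE s a).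
rewrite (deltaE p d) (deltaE q d) (deltaE r d) (deltaE s d).
rewrite /ss /sgn; case: (par a); case: (par d).
all: rewrite /= ?(mul0r, mulr0, mul1r, add0r,addr0,subr0,oppr0).
all: by sign_cases p q r s.
Qed.

Definition dyad (p q : I) : form2 := fun a b => delta p a * delta q b.

Lemma str_dyad p q : str g (dyad p q) = g q p.
Proof. exact: (sum_delta2 p q (fun a d => g d a)). Qed.

Lemma sum_otimes_E p q a b c d :
  \sum_x \sum_y g x y * otimes (E p x) (E y q) a b c d =
  4 * phimap g (dyad p q) a b c d.
Proof.
have e k u v : \sum_x \sum_y g x y * (k * (delta x u * delta y v)) = k * g u v.
  rewrite -(sum_delta2 u v (fun x y => k * g x y)).
  apply: eq_bigr => x _; apply: eq_bigr => y _.
  by rewrite /delta (eq_sym u x) (eq_sym v y); ring.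
transitivity (delta p a * delta q d * g b c
  - ss a b * (delta p b * delta q d) * g a c
  - ss c d * (delta p a * delta q c) * g b d
  + ss a b * ss c d * (delta p b * delta q c) * g a d).
  rewrite -!e -!sumrN -!big_split; apply: eq_bigr => x _ /=.
  rewrite -!sumrN -!big_split; apply: eq_bigr => y _ /=.
  (* The index form of [E] is used rather than [E_label], because its signs do not involve the
     summed labels [x] and [y]. *)
  by rewrite /otimes /E; ring.
by rewrite /phimap /dyad; field.
Qed.

End Generators.

(** * The tensor algebra as functions on words under the deconcatenation product *)

Section TensorAlgebra.
Variables (C : numClosedFieldType) (m n : nat).
Local Notation I := 'I_(m + n.*2).
Local Notation tens := (tens C m n).
Local Notation tmul := (@tmul C m n).
Local Notation form2 := (I -> I -> C).
Local Notation in_TG := (@in_TG C m n).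
Implicit Types (t u v : tens) (s : seq I).

Definition tone : tens := fun s => if s is [::] then 1 else 0.

Lemma tmul_nil t u : tmul t u [::] = t [::] * u [::].
Proof. by rewrite /tmul big_ord1. Qed.

(** A word is cut either before its first letter or later; the later cuts involve the left
    derivative of [t] by [a]. Inductions on words therefore keep [t] general. *)
Lemma tmul_cons t u a s :
  tmul t u (a :: s) = t [::] * u (a :: s) + tmul (fun w => t (a :: w)) u s.
Proof. by rewrite /tmul big_ord_recl. Qed.

Lemma tmul0l u s : tmul (fun _ => 0) u s = 0.
Proof. by rewrite /tmul big1 // => i _; rewrite mul0r. Qed.

Lemma tmul_ext t t' u u' s : t =1 t' -> u =1 u' -> tmul t u s = tmul t' u' s.
Proof. by move=> et eu; apply: eq_bigr => i _; rewrite et eu. Qed.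

Lemma tmulDl t t' k u s :
  tmul (fun w => t w + k * t' w) u s = tmul t u s + k * tmul t' u s.
Proof.
by rewrite /tmul mulr_sumr -big_split; apply: eq_bigr => i _ /=; ring.
Qed.

Lemma tmulDr t u k u' s :
  tmul t (fun w => u w + k * u' w) s = tmul t u s + k * tmul t u' s.
Proof.
by rewrite /tmul mulr_sumr -big_split; apply: eq_bigr => i _ /=; ring.
Qed.

Lemma tmulZl k t u s : tmul (fun w => k * t w) u s = k * tmul t u s.
Proof. by rewrite /tmul mulr_sumr; apply: eq_bigr => i _ /=; ring. Qed.

Lemma tmulZr k t u s : tmul t (fun w => k * u w) s = k * tmul t u s.
Proof. by rewrite /tmul mulr_sumr; apply: eq_bigr => i _ /=; ring. Qed.

Lemma tmul_sumr (K : finType) t (F : K -> tens) s :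
  tmul t (fun w => \sum_k F k w) s = \sum_k tmul t (F k) s.
Proof.
by rewrite /tmul exchange_big; apply: eq_bigr => i _; rewrite mulr_sumr.
Qed.

Lemma tmul1l t s : tmul tone t s = t s.
Proof.
case: s => [|a s]; first by rewrite tmul_nil mul1r.
by rewrite tmul_cons tmul0l mul1r addr0.
Qed.

Lemma tmul1r t s : tmul t tone s = t s.
Proof.
elim: s t => [|a s IHs] t; first by rewrite tmul_nil mulr1.
by rewrite tmul_cons IHs mulr0 add0r.
Qed.

Lemma tmulA t u v s : tmul (tmul t u) v s = tmul t (tmul u v) s.
Proof.
elim: s t => [|a s IHs] t; first by rewrite !tmul_nil mulrA.
rewrite !tmul_cons tmul_nil.
rewrite (tmul_ext _ (fun w => tmul_cons t u a w) (fun w => erefl (v w))).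
(* The summands are swapped to match the shape [t + k * t'] of [tmulDl]. *)
have e w : t [::] * u (a :: w) + tmul (fun w' => t (a :: w')) u w =
    tmul (fun w' => t (a :: w')) u w + t [::] * u (a :: w) by rewrite addrC.
rewrite (tmul_ext _ e (fun w => erefl (v w))) tmulDl IHs.
by ring.
Qed.

Lemma tmul_t1 (X Y : form2) s : tmul (t1 X) (t1 Y) s =
  if s is [:: a; b; c; d] then X a b * Y c d else 0.
Proof.
case: s => [|a [|b [|c s]]].
- by rewrite tmul_nil mul0r.
- by rewrite tmul_cons tmul_nil /= !mul0r addr0.
- by rewrite !tmul_cons tmul_nil /= !(mul0r, mulr0, addr0).
rewrite !tmul_cons tmul0l /= !mul0r !add0r addr0.
by case: s => [|d [|e s]]; rewrite ?mulr0.
Qed.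

Lemma tone_TG : in_TG tone.
Proof.
split; first by exists 0%N; case.
- by case.
- by move=> [|x s1] s2 a b _ /=; rewrite mulr0 oppr0.
Qed.

Lemma t1_TG (X : form2) : in_osp X -> in_TG (t1 X).
Proof.
move=> oX; split; first by exists 2%N; case=> [|a [|b [|c s]]].
- by case=> [|a [|b [|c s]]].
move=> [|x [|y s1]] [|z s2] a b //= _; rewrite ?mulr0 ?oppr0 //.
all: case: s1 => [|w s1] /=; by rewrite mulr0 oppr0.
Qed.

End TensorAlgebra.

(** * Relations in the ideal, and the elements of the Lie algebra they force into it *)

Section Ideal.
Variables (C : numClosedFieldType) (m n : nat).
Local Notation I := 'I_(m + n.*2).
Variable g : I -> I -> C.
Hypothesis g_osp : is_osp_metric g.
Local Notation M := (Mval C m n).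
Local Notation ss := (@ss C m n).
Local Notation swsign := (@swsign C m n).
Local Notation T4 := (T4 C m n).
Local Notation form2 := (I -> I -> C).
Local Notation in_osp := (@in_osp C m n).
Local Notation in_gg := (@in_gg C m n).
Hypotheses (M1 : M != 1) (M2 : M != 2).
Variable lam : C.
Local Notation tens := (tens C m n).
Local Notation tmul := (@tmul C m n).
Local Notation in_TG := (@in_TG C m n).
Local Notation inJ := (inJ g lam).
Local Notation tone := (@tone C m n).
Local Notation E := (@E C m n).
Local Notation cycsign := (@cycsign C m n).
Local Notation cyc := (@cyc C m n).
Local Notation dyad := (@dyad C m n).
Local Notation delta := (@delta C m n).
Implicit Types (t u v : tens) (T U : T4) (X Y : form2).

Lemma inJ_ext t u : t =1 u -> inJ u -> inJ t.
Proof. by move=> /functional_extensionality->. Qed.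

Lemma inJ_lin t u k : inJ t -> inJ u -> inJ (fun s => t s + k * u s).
Proof. by move=> Jt Ju; apply: inJadd => //; apply: inJscale. Qed.

Lemma inJ_sum (K : finType) (F : K -> tens) :
  (forall k, inJ (F k)) -> inJ (fun s => \sum_k F k s).
Proof.
move=> JF; elim: (index_enum K) => [|k r IHr].
  by apply: inJ_ext (inJ0 _ _) => s; rewrite big_nil.
by apply: inJ_ext (inJadd (JF k) IHr) => s; rewrite big_cons.
Qed.

(** The other components are [qmap] of the symmetric part, [phimap] of the corrected trace, and the
    super-antisymmetric part under exchange of pairs. *)
Lemma proj_cartan1_comp X Y : in_osp X -> in_osp Y ->
  is_cartan1_comp g X Y (proj g (otimes X Y)).
Proof.
move=> oX oY; set T := otimes X Y; have Tgg : in_gg T by apply: otimes_gg.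
split; first exact: proj_cartan.
exists (sym T), (ztr g (tr g (nonalt T))),
  (fun a b c d => 2^-1 * (T a b c d - swsign a b c d * T c d a b)).
split.
- exact: sym_sym2.
- exact/(ztr_sym1 g_osp)/(tr_sym1 g_osp)/nonalt_sym2.
- split=> a b c d; last by sign_cases a b c d.
  split.
  + case: (Tgg a b c d) => -> _; case: (Tgg c d a b) => _ ->.
    by sign_cases a b c d.
  + case: (Tgg a b c d) => _ ->; case: (Tgg c d a b) => -> _.
    by sign_cases a b c d.
move=> a b c d; rewrite -[X a b * Y c d]/(T a b c d) /proj /nonalt {1 3}/sym.
by field.
Qed.

(* [genel X Y V], with V the Cartan component of X (x) Y, extended linearly
   from X (x) Y to T. *)
Definition dten T : tens := fun s =>
  match s with
  | [::] => - (lam * str g (tr g T))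
  | [:: a; b] => - (2^-1 * (tr g T a b - ss a b * tr g T b a))
  | [:: a; b; c; d] => T a b c d - proj g T a b c d
  | _ => 0
  end.

Lemma genel_otimes X Y s :
  genel g lam X Y (proj g (otimes X Y)) s = dten (otimes X Y) s.
Proof.
have eb a b : tr g (otimes X Y) a b = \sum_c lowr g X a c * Y c b.
  apply: eq_bigr => c _; rewrite /lowr mulr_suml; apply: eq_bigr => d _.
  by rewrite mulrA.
case: s => [|a [|b [|c [|d [|e s]]]]] //=.
  congr (- (_ * _)); rewrite /form /lowboth /str [RHS]exchange_big.
  apply: eq_bigr => a _ /=.
  under eq_bigr => b _ do rewrite mulr_suml.
  rewrite exchange_big; apply: eq_bigr => c _ /=; rewrite /tr mulr_sumr.
  apply: eq_bigr => b _; rewrite mulr_suml mulr_sumr; apply: eq_bigr => d _.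
  by rewrite /otimes; ring.
by rewrite !eb mulr_sumr -sumrB; congr (- (_ * _)); apply: eq_bigr => c _; ring.
Qed.

Lemma dtenD T U k s :
  dten (fun a b c d => T a b c d + k * U a b c d) s = dten T s + k * dten U s.
Proof.
case: s => [|a [|b [|c [|d [|e s]]]]] //=; rewrite ?mulr0 ?addr0 //.
- have -> : tr g (fun a b c d => T a b c d + k * U a b c d) =
            fun a d => tr g T a d + k * tr g U a d.
    by apply: funext2 => *; rewrite trD.
  by rewrite strD; ring.
- by rewrite !trD; ring.
- by rewrite projD //; ring.
Qed.

(** Linear in [T], and stable under multiplication on both sides by construction: relations can be
    combined as 4-tensors before passing to the tensor algebra. *)
Definition in_ker T := forall u v, in_TG u -> in_TG v ->
  inJ (tmul (tmul u (dten T)) v).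

Lemma in_ker_otimes X Y : in_osp X -> in_osp Y -> in_ker (otimes X Y).
Proof.
move=> oX oY u v uG vG; have comp := proj_cartan1_comp oX oY.
apply: inJ_ext (inJgen lam uG vG oX oY comp) => s.
by apply: tmul_ext => // w; apply: tmul_ext => // x; rewrite genel_otimes.
Qed.

Lemma in_kerD T U k : in_ker T -> in_ker U ->
  in_ker (fun a b c d => T a b c d + k * U a b c d).
Proof.
move=> kT kU u v uG vG.
apply: inJ_ext (inJ_lin k (kT u v uG vG) (kU u v uG vG)) => s.
rewrite -tmulDl; apply: tmul_ext => // w; rewrite -tmulDr.
by apply: tmul_ext => // x; rewrite dtenD.
Qed.

Lemma in_ker_ext T U : (forall a b c d, T a b c d = U a b c d) ->
  in_ker U -> in_ker T.
Proof. by move=> /funext4->. Qed.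

Lemma in_ker0 : in_ker (fun _ _ _ _ => 0).
Proof.
have k0 : in_ker (otimes (fun _ _ => 0) (fun _ _ => 0)).
  by apply: in_ker_otimes => a b; rewrite mulr0 oppr0.
by apply: in_ker_ext k0 => *; rewrite /otimes mulr0.
Qed.

Lemma in_ker_sum (K : finType) (k : K -> C) (F : K -> T4) :
  (forall i, in_ker (F i)) ->
  in_ker (fun a b c d => \sum_i k i * F i a b c d).
Proof.
move=> kF; elim: (index_enum K) => [|i r IHr].
  by apply: in_ker_ext in_ker0 => *; rewrite big_nil.
by apply: in_ker_ext (in_kerD (k i) IHr (kF i)) => *; rewrite big_cons addrC.
Qed.

Definition L p q : tens := t1 (E p q).
Definition LL p q r s : tens := tmul (L p q) (L r s).

(** This is G_pqrs with its signs; [cyc_rel] and [square_rel] below are (1) and (2), each written as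
    left side minus right side. *)
Definition cyc_trace p q r s : tens := fun w =>
  g s r * L p q w + cycsign p q r * g s p * L q r w
  + cycsign r p q * g s q * L r p w.

Definition cyc_rel p q r s : tens := fun w =>
  LL p q r s w + cycsign p q r * LL q r p s w + cycsign r p q * LL r p q s w
  - cyc_trace p q r s w.

Definition square p q : tens := fun w =>
  \sum_x \sum_y g x y * LL p x y q w.

Definition square_rel p q : tens := fun w =>
  square p q w
  - (2 * (M - 1) * lam * g q p * tone w + (M - 2) / 2 * L p q w).

Lemma L_TG p q : in_TG (L p q).
Proof. exact/t1_TG/E_osp. Qed.

Lemma in_ker_cyc p q r s : in_ker (cyc p q r s).
Proof.
by do 2?[apply: in_kerD => //]; apply: in_ker_otimes => //; apply: E_osp.
Qed.

(** By word length: the forms cancel in length 0, the half brackets give G_pqrs in length 2, and the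
    Cartan component vanishes in length 4. *)
Lemma dten_cyc p q r s w : dten (cyc p q r s) w = cyc_rel p q r s w.
Proof.
rewrite /cyc_rel /cyc_trace /LL !tmul_t1.
case: w => [|a [|b [|c [|d [|e w]]]]] /=.
all: rewrite !(mulr0, addr0, subr0, add0r, oppr0) //.
- by rewrite str_tr_cyc // mulr0 oppr0.
- by rewrite bracket_cyc.
rewrite proj_alt ?subr0 // => [|*]; last exact: sym_cyc_alt.
have gg p1 p2 p3 p4 := otimes_gg (@E_osp C m n p1 p2) (@E_osp C m n p3 p4).
move=> x y z t; case: (gg p q r s x y z t) (gg q r p s x y z t)
  (gg r p q s x y z t) => e1 f1 [e2 f2] [e3 f3].
by rewrite /cyc; split; [rewrite e1 e2 e3|rewrite f1 f2 f3]; ring.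
Qed.

Lemma inJ_cyc_rel p q r s u v : in_TG u -> in_TG v ->
  inJ (tmul (tmul u (cyc_rel p q r s)) v).
Proof.
move=> uG vG; apply: inJ_ext (in_ker_cyc p q r s uG vG) => w.
by apply: tmul_ext => // x; apply: tmul_ext => // y; rewrite dten_cyc.
Qed.

(** The tensor is four times [phimap] of a dyad, so it has no Cartan component. Its trace has [str]
    equal to ((M - 2) + M) g_qp, whence mu; super-antisymmetrizing the trace removes the metric term
    and leaves nu. *)
Lemma dten_square p q w :
  dten (fun a b c d =>
    \sum_x \sum_y g x y * otimes (E p x) (E y q) a b c d) w = square_rel p q w.
Proof.
have -> : (fun a b c d => \sum_x \sum_y g x y * otimes (E p x) (E y q) a b c d)
        = (fun a b c d => 0 + 4 * phimap g (dyad p q) a b c d).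
  by apply: funext4 => *; rewrite sum_otimes_E // add0r.
have z2 x y : tr g (fun _ _ _ _ => 0) x y = 0.
  by rewrite /tr big1 // => ? _; rewrite big1 // => ? _; rewrite mulr0.
have etr : tr g (fun a b c d => 0 + 4 * phimap g (dyad p q) a b c d) =
    fun a d => (M - 2) * dyad p q a d + g q p * g a d.
  by apply: funext2 => a d; rewrite trD z2 tr_phimap // str_dyad; field.
rewrite /square_rel /square /LL.
under eq_bigr => x _ do under eq_bigr => y _ do rewrite tmul_t1.
case: w => [|a [|b [|c [|d [|e w]]]]] /=.
all: try by rewrite big1 ?mulr0 ?addr0 ?subr0 // => x _;
  rewrite big1 // => y _; rewrite mulr0.
- rewrite etr strD strZ str_dyad str_metric // big1; last first.
    by move=> x _; rewrite big1 // => y _; rewrite mulr0.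
  by ring.
- rewrite etr big1; last by move=> x _; rewrite big1 // => y _; rewrite mulr0.
  rewrite E_label /dyad (metric_flip g_osp a b) (metricE g_osp a b).
  rewrite (deltaE C p a) (deltaE C q a) (deltaE C p b) (deltaE C q b).
  by sign_cases a b p q.
rewrite projD // proj_phimap // sum_otimes_E //.
(* Linearity with coefficient -1 writes this value as its difference with itself. *)
have -> : proj g (fun _ _ _ _ => 0) a b c d = 0.
  have h := @projD C m n g (fun _ _ _ _ => 0) (fun _ _ _ _ => 0) (-1) a b c d.
  rewrite [X in _ = _ + X]mulN1r [RHS]subrr in h; rewrite -[RHS]h.
  congr (proj g _ a b c d).
  by apply: funext4 => *; rewrite mulr0 addr0.
by ring.
Qed.

Lemma inJ_square_rel p q u v : in_TG u -> in_TG v ->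
  inJ (tmul (tmul u (square_rel p q)) v).
Proof.
move=> uG vG; have key : in_ker (fun a b c d =>
    \sum_x \sum_y g x y * otimes (E p x) (E y q) a b c d).
  have : forall x, in_ker (fun a b c d =>
      \sum_y g x y * otimes (E p x) (E y q) a b c d).
    move=> x; apply: in_ker_sum => // y.
    by apply: in_ker_otimes => //; apply: E_osp.
  move/(in_ker_sum (fun=> 1)).
  apply: in_ker_ext => a b c d.
  by apply: eq_bigr => x _; rewrite mul1r.
apply: inJ_ext (key u v uG vG) => w.
by apply: tmul_ext => // x; apply: tmul_ext => // y; rewrite dten_square.
Qed.

(** The coefficient is mu + nu - 1, obtained by evaluating the contraction of (1) times [L y e] in
    two ways. *)
Lemma inJ_cyc_trace a b c e :
  inJ (fun w => (2 * (M - 1) * lam + (M - 4) / 2) * cyc_trace a b c e w).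
Proof.
have ctr p q (F : I -> C) : \sum_x \sum_y g x y * (g x p * (q * F y)) = q * F p.
  rewrite exchange_big -(sum_deltal p (fun y => q * F y)).
  apply: eq_bigr => y _.
  rewrite eq_sym -(metric_orthl g_osp) mulr_suml; apply: eq_bigr => x _; ring.
have sq p q k : (fun w => \sum_x \sum_y g x y * tmul (LL p q k x) (L y e) w)
    =1 tmul (L p q) (square k e).
  move=> w; rewrite /square tmul_sumr; apply: eq_bigr => x _.
  rewrite tmul_sumr; apply: eq_bigr => y _.
  by rewrite tmulZr /LL tmulA.
have J1 : inJ (fun w => \sum_x \sum_y g x y * tmul (cyc_rel a b c x) (L y e) w).
  apply: inJ_sum => x; apply: inJ_sum => y; apply: inJscale.
  apply: inJ_ext (inJ_cyc_rel a b c x (tone_TG C m n) (L_TG y e)) => w.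
  by apply: tmul_ext => // z; rewrite tmul1l.
have J2 p q k : inJ (tmul (L p q) (square_rel k e)).
  apply: inJ_ext (inJ_square_rel k e (L_TG p q) (tone_TG C m n)) => w.
  by rewrite tmul1r.
have J3 : inJ (cyc_rel a b c e).
  apply: inJ_ext (inJ_cyc_rel a b c e (tone_TG C m n) (tone_TG C m n)) => w.
  by rewrite tmul1r tmul1l.
(* By [sq] the cubic terms become products with squares; by [ctr] the contracted G_abcx terms become
   the left side of (1) for (a, b, c, e). *)
have {J1}J1 : inJ (fun w => tmul (L a b) (square c e) w
    + cycsign a b c * tmul (L b c) (square a e) w
    + cycsign c a b * tmul (L c a) (square b e) w
    - (LL a b c e w + cycsign a b c * LL b c a e w
       + cycsign c a b * LL c a b e w)).
  apply: inJ_ext J1 => w; rewrite -!sq.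
  have c1 := ctr c 1 (fun y => LL a b y e w).
  have c2 := ctr a (cycsign a b c) (fun y => LL b c y e w).
  have c3 := ctr b (cycsign c a b) (fun y => LL c a y e w).
  rewrite mul1r in c1; rewrite -c1 -c2 -c3.
  rewrite !mulr_sumr -!big_split -sumrN -big_split; apply: eq_bigr => x _ /=.
  rewrite !mulr_sumr -!big_split -sumrN -big_split; apply: eq_bigr => y _ /=.
  have -> : tmul (cyc_rel a b c x) (L y e) w =
     tmul (LL a b c x) (L y e) w + cycsign a b c * tmul (LL b c a x) (L y e) w
     + cycsign c a b * tmul (LL c a b x) (L y e) w
     + (-1) * (g x c * LL a b y e w + cycsign a b c * g x a * LL b c y e w
               + cycsign c a b * g x b * LL c a y e w).
    rewrite /LL -(tmulZl (g x c)) -!tmulDl.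
    by apply: tmul_ext => // z; rewrite /cyc_rel /cyc_trace /LL; ring.
  by ring.
have e2 p q k w : tmul (L p q) (square_rel k e) w = tmul (L p q) (square k e) w
    + - (2 * (M - 1) * lam * g e k) * L p q w
    + - ((M - 2) / 2) * LL p q k e w.
  rewrite /LL -[L p q w]tmul1r -!tmulDr; apply: tmul_ext => // z.
  by rewrite /square_rel; ring.
(* Eliminating the three squares by (2) leaves mu G_abce plus nu - 1 = (M - 4) / 2 times the left
   side of (1); subtracting that multiple of (1) turns the latter into G_abce. *)
have := inJ_lin (- ((M - 4) / 2)) (inJ_lin (- cycsign c a b) (inJ_lin
  (- cycsign a b c) (inJ_lin (-1) J1 (J2 a b c)) (J2 b c a)) (J2 c a b)) J3.
by move=> J; apply: inJ_ext J => w; rewrite !e2 /cyc_rel /cyc_trace; field.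
Qed.

Lemma L_flip p q w : L q p w = - (ss p q * L p q w).
Proof.
case: w => [|a [|b [|c w]]] //=; rewrite ?mulr0 ?oppr0 //; exact: E_flip.
Qed.

(** The first term of G_abce closes a loop and gives [M]; each of the other two returns [L b a] with
    a sign, that is [- L a b]. *)
Lemma contract_cyc_trace a b w :
  \sum_c \sum_e g c e * cyc_trace a b c e w = (M - 2) * L a b w.
Proof.
have e1 : \sum_c \sum_e g c e * g e c = M.
  rewrite -(sum_ss C m n); apply: eq_bigr => c _.
  by rewrite metric_orthm // eqxx mulr1.
have e2 p (F : I -> C) : \sum_c \sum_e g c e * (g e p * F c) = ss p p * F p.
  rewrite -(sum_deltal p (fun c => ss c c * F c)); apply: eq_bigr => c _.
  under eq_bigr => e _ do rewrite mulrA.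
  by rewrite -mulr_suml metric_orthm // eq_sym; ring.
transitivity (\sum_c \sum_e g c e * g e c * L a b w
  + \sum_c \sum_e g c e * (g e a * (cycsign a b c * L b c w))
  + \sum_c \sum_e g c e * (g e b * (cycsign c a b * L c a w))).
  rewrite -!big_split; apply: eq_bigr => c _ /=.
  by rewrite -!big_split; apply: eq_bigr => e _; rewrite /cyc_trace /=; ring.
under eq_bigr => c _ do rewrite -mulr_suml.
rewrite -mulr_suml e1 (e2 a (fun c => cycsign a b c * L b c w)).
rewrite (e2 b (fun c => cycsign c a b * L c a w)) (L_flip a b) /cycsign.
by sign_cases a b a b.
Qed.

Lemma inJ_L a b : lam != - ((M - 4) / (4 * (M - 1))) -> inJ (L a b).
Proof.
move=> lamN; set k := 2 * (M - 1) * lam + (M - 4) / 2.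
have M1' : M - 1 != 0 by rewrite subr_eq0.
have M2' : M - 2 != 0 by rewrite subr_eq0.
have k0 : k != 0.
  (* This factorization shows that [k] vanishes only at the excluded value of [lam]. *)
  have -> : k = 2 * (M - 1) * (lam + (M - 4) / (4 * (M - 1))).
    by rewrite /k; field.
  by rewrite !mulf_neq0 ?pnatr_eq0 // addr_eq0.
have J : inJ (fun w => \sum_c \sum_e g c e * (k * cyc_trace a b c e w)).
  by apply: inJ_sum => c; apply: inJ_sum => e; apply/inJscale/inJ_cyc_trace.
apply: inJ_ext (inJscale (k * (M - 2))^-1 J) => w.
have -> : \sum_c \sum_e g c e * (k * cyc_trace a b c e w)
       = k * ((M - 2) * L a b w).
  rewrite -contract_cyc_trace mulr_sumr; apply: eq_bigr => c _.
  by rewrite mulr_sumr; apply: eq_bigr => e _; ring.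
by field; apply/andP.
Qed.

(** The [L p q] span the Lie algebra; the factor 1/2 compensates for counting both (p, q) and (q,
    p). *)
Lemma t1_sum_L X w : in_osp X ->
  t1 X w = \sum_p \sum_q 2^-1 * X p q * L p q w.
Proof.
move=> oX; case: w => [|a [|b [|c w]]] /=.
1,2,4: by rewrite big1 // => p _; rewrite big1 // => q _; rewrite mulr0.
have e k x y : \sum_p \sum_q k * X p q * (delta p x * delta q y) = k * X x y.
  rewrite -(sum_delta2 x y (fun p q => k * X p q)).
  apply: eq_bigr => p _; apply: eq_bigr => q _.
  by rewrite /delta (eq_sym x) (eq_sym y).
transitivity (2^-1 * X a b + - (2^-1 * ss a b) * X b a).
  by rewrite (oX b a) (ssC C b a); sign_cases a b a b.
rewrite -!e -big_split; apply: eq_bigr => p _.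
by rewrite -big_split; apply: eq_bigr => q _; rewrite /= /E; ring.
Qed.

End Ideal.

Theorem theorem5p2 (C : numClosedFieldType) (m n : nat)
    (g : 'I_(m + n.*2) -> 'I_(m + n.*2) -> C) (lam : C) :
  (4 < m)%N -> (1 < n)%N -> is_osp_metric g ->
  Mval C m n != 1 -> Mval C m n != 2 ->
  lam != - ((Mval C m n - 4) / (4 * (Mval C m n - 1))) ->
  forall X : 'I_(m + n.*2) -> 'I_(m + n.*2) -> C,
    in_osp X -> inJ g lam (t1 X).
Proof.
move=> _ _ g_osp M1 M2 lamN X oX.
apply: (@inJ_ext _ _ _ _ _ _ (fun w => \sum_p \sum_q 2^-1 * X p q * L C p q w)).
  by move=> w; apply: t1_sum_L.
by apply: inJ_sum => p; apply: inJ_sum => q; apply/inJscale/inJ_L.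
Qed.
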